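(* Let $n\geq 1$ and let $\sigma\vdash[k]$ and $\tau\vdash[l]$ be set partitions. In $\mathrm{NCSym}$, the coefficient of $x_\sigma\otimes x_\tau$ in $\Delta(x_{\llbracket n\rrbracket})$ (expanded in the basis of tensors $x_{\alpha}\otimes x_{\beta}$, with $\alpha,\beta$ set partitions) is $$\sum (-1)^{\ell(\nu)-1}(\ell(\nu)-1)!,$$ where the sum is over all triples $(\nu,S_1,S_2)$ such that $\nu\vdash[n]$, $[n]=S_1\sqcup S_2$, $\nu=\nu|_{S_1}\sqcup\nu|_{S_2}$, $\sigma\leq \mathrm{St}(\nu|_{S_1})$, and $\tau\leq\mathrm{St}(\nu|_{S_2})$.
   Context: $[n]=\{1,\dots,n\}$, $[0]=\emptyset$. A set partition $\pi\vdash S$ of a finite set $S$ is a collection of disjoint nonempty subsets (blocks) with union $S$; $\ell(\pi)$ is its number of blocks; the empty set has a unique set partition $\emptyset$. $\llbracket n\rrbracket\vdash[n]$ is the set partition with a single block $[n]$. A decomposition $[n]=S_1\sqcup S_2$ is an ordered pair of disjoint, possibly empty, subsets with union $[n]$. For $T\subseteq S$, $\pi|_T$ is the set partition of $T$ whose blocks are the nonempty intersections of blocks of $\pi$ with $T$. For set partitions $A$ and $B$ of disjoint sets, $A\sqcup B$ is the set partition of the union whose blocks are the blocks of $A$ together with those of $B$. For a finite set $S$ of integers and $A\vdash S$, $\mathrm{St}(A)\vdash[|S|]$ is obtained by relabelling via the unique order-preserving bijection $S\to[|S|]$. Set partitions of a common set are ordered by refinement: $\sigma\leq\pi$ if each block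 of $\sigma$ is contained in a block of $\pi$ (so $\sigma\leq \mathrm{St}(\nu|_{S_1})$ requires in particular that both are set partitions of the same set, i.e. $|S_1|=k$, and likewise $|S_2|=l$). $u$ is the Möbius function of the refinement lattice: for $\sigma\le\pi$, $u(\sigma,\pi)=\prod_i(-1)^{\lambda_i-1}(\lambda_i-1)!$ with $\lambda_i$ the number of blocks of $\sigma$ contained in the $i$th block of $\pi$. $\mathrm{NCSym}$ is the Hopf algebra of symmetric functions in noncommuting variables over $\mathbb{Q}$. It is graded, with basis $\{p_\pi\}$ indexed by all set partitions $\pi\vdash[n]$, $n\ge0$ ($p_\emptyset=1$), where $p_\pi=\sum \mathbf{x}_{i_1}\cdots\mathbf{x}_{i_n}$ over all tuples of positive integers $(i_1,\dots,i_n)$ with $i_j=i_k$ whenever $j,k$ are in the same block of $\pi$, the $\mathbf{x}_i$ being noncommuting variables. Its coproduct is the linear map determined by $$\Delta(p_\pi)=\sum_{[n]=S_1\sqcup S_2:\ \pi=\pi|_{S_1}\sqcup\pi|_{S_2}}p_{\mathrm{St}(\pi|_{S_1})}\otimes p_{\mathrm{St}(\pi|_{S_2})}\qquad(\pi\vdash[n]).$$ The $x$-basis of $\mathrm{NCSym}$ is $\{x_\pi\}$, where $x_\pi=\sum_{\sigma\leq\pi}u(\sigma,\pi)\,p_\sigma$. *)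

(* Defs.v *)
From HB Require Import structures.
From mathcomp Require Import all_boot all_order all_algebra.
From mathcomp Require Import finmap.
From mathcomp Require Import boolp functions.

Set Implicit Arguments.
Unset Strict Implicit.
Unset Printing Implicit Defensive.

Import GRing.Theory.

Local Open Scope ring_scope.

(* [n] is modelled by 'I_n = {0, .., n-1}; only the order of its elements
   matters (in std below). *)
Definition setpart (n : nat) :=
  {P : {set {set 'I_n}} | partition P [set: 'I_n]}.

(* The set partitions of all the [n], which index the bases. *)
Definition spart := {n : nat & setpart n}.

Definition nblocks n (pi : setpart n) : nat := #|val pi|.

Definition refines n (sigma pi : setpart n) : bool :=
  [forall B in val sigma, exists C in val pi, B \subset C].

(* Refinement in spart: partitions of different [n] are never comparable.
   When the tags agree, tagged_as is the transport along their equality. *)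
Definition srefines (a b : spart) : bool :=
  (tag a == tag b) && refines (tagged a) (tagged_as a b).

Lemma one_block_subproof n : (0 < n)%N ->
  partition [set [set: 'I_n]] [set: 'I_n].
Proof.
move=> n_gt0; rewrite /partition /cover big_set1 eqxx /= trivIset1 inE /=.
rewrite eq_sym; apply/set0Pn.
by exists (Ordinal n_gt0); rewrite inE.
Qed.

Definition one_block n (n_gt0 : (0 < n)%N) : setpart n :=
  exist _ [set [set: 'I_n]] (one_block_subproof n_gt0).

Definition restr n (P : {set {set 'I_n}}) (T : {set 'I_n}) : {set {set 'I_n}} :=
  [set B :&: T | B in P] :\ set0.

(* enum_val : 'I_#|S| -> 'I_n is the increasing enumeration of S. *)
Definition std n (S : {set 'I_n}) (A : {set {set 'I_n}}) :
    {set {set 'I_#|S|}} :=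
  [set (@enum_val _ (mem S)) @^-1: B | B : {set 'I_n} in A].

Lemma restr_partition n (P : {set {set 'I_n}}) (T : {set 'I_n}) :
  partition P [set: 'I_n] -> partition (restr P T) T.
Proof.
move=> partP; have tiP := partition_trivIset partP.
apply/and3P; split; last by rewrite !inE eqxx.
  apply/eqP/setP=> i; apply/bigcupP/idP => [[C]|iT].
    by rewrite !inE => /andP[_ /imsetP[B _ ->]]; rewrite inE => /andP[].
  have := in_setT i; rewrite -(cover_partition partP) => /bigcupP[B BP iB].
  exists (B :&: T); last by rewrite inE iB.
  apply/setD1P; split; last exact: imset_f.
  by apply/set0Pn; exists i; rewrite inE iB.
apply/trivIsetP => C D; rewrite !inE.
move=> /andP[_ /imsetP[B BP ->]] /andP[_ /imsetP[B' BP' ->]] neq.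
have neqB : B != B' by apply: contraNneq neq => ->.
have /trivIsetP/(_ B B' BP BP' neqB) := tiP.
by apply: disjointW; apply: subsetIl.
Qed.

Lemma std_partition n (S : {set 'I_n}) (A : {set {set 'I_n}}) :
  partition A S -> partition (std S A) [set: 'I_#|S|].
Proof.
move=> partA; have tiA := partition_trivIset partA.
apply/and3P; split.
- apply/eqP/setP=> i; rewrite inE; apply/bigcupP.
  have := enum_valP i; rewrite -{2}(cover_partition partA) => /bigcupP[B BA iB].
  by exists (enum_val @^-1: B); [apply: imset_f | rewrite inE].
- apply/trivIsetP => C D /imsetP[B BA ->] /imsetP[B' BA' ->] neq.
  have neqB : B != B' by apply: contraNneq neq => ->.
  have /trivIsetP/(_ B B' BA BA' neqB) := tiA.
  rewrite -!setI_eq0 => /eqP BB'0; apply/eqP/setP => i.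
  by have /setP/(_ (enum_val i)) := BB'0; rewrite !inE.
- apply/imsetP => -[B BA /setP B0].
  have /set0Pn[i iB] := partition_neq0 partA BA.
  have iS : i \in S by apply: subsetP iB; apply: partitionS BA.
  by have := B0 (enum_rank_in iS i); rewrite !inE enum_rankK_in ?iB.
Qed.

(* St(pi|_T) *)
Definition std_restr n (pi : setpart n) (T : {set 'I_n}) : spart :=
  Tagged setpart
    (exist _ (std T (restr (val pi) T))
      (std_partition (restr_partition T (valP pi))) : setpart #|T|).

Definition decomposition n (S1 S2 : {set 'I_n}) : bool :=
  [disjoint S1 & S2] && (S1 :|: S2 == [set: 'I_n]).

Definition splits n (pi : setpart n) (S1 S2 : {set 'I_n}) : bool :=
  val pi == restr (val pi) S1 :|: restr (val pi) S2.

(* The value of the Moebius function when sigma refines pi; it is only used in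
   this case, so that every lambda below is positive. *)
Definition moebius n (sigma pi : setpart n) : rat :=
  \prod_(C in val pi)
    let lambda := #|[set B in val sigma | B \subset C]| in
    (-1) ^+ lambda.-1 * (lambda.-1)`!%:R.

(* A formal power series with rational coefficients in the noncommuting
   variables x_0, x_1, x_2, .. is the function giving the coefficient of each
   word [:: i_1; ..; i_n], i.e., of the monomial x_(i_1) .. x_(i_n).  The
   variables are numbered from 0 instead of 1. *)
Definition word := seq nat.

Definition ncsym_pred : {pred word -> rat^o} := fun f =>
  `[< (exists d : nat, forall w : word, (d < size w)%N -> f w = 0) /\
      (forall s : nat -> nat, bijective s -> forall w, f (map s w) = f w) >].

Lemma ncsym_submod_closed : submod_closed ncsym_pred.
Proof.
split=> [|a f g /asboolP[[d fd] fs] /asboolP[[e ge] gs]]; apply/asboolP.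
  by split; [exists 0%N|].
split=> [|s bs w].
  exists (maxn d e) => w; rewrite gtn_max => /andP[dw ew].
  change (a * f w + g w = 0); by rewrite fd // ge // mulr0 addr0.
change (a * f (map s w) + g (map s w) = a * f w + g w).
by rewrite fs // gs.
Qed.

HB.instance Definition _ :=
  GRing.isSubmodClosed.Build rat (word -> rat^o) ncsym_pred ncsym_submod_closed.

Record ncsym := NCSym { nc_val :> word -> rat^o; _ : nc_val \in ncsym_pred }.

HB.instance Definition _ := [isSub for nc_val].
HB.instance Definition _ := [Choice of ncsym by <:].
HB.instance Definition _ := [SubChoice_isSubLmodule of ncsym by <:].

(* NCSym (x) NCSym is realized inside the formal power series in two sets of
   noncommuting variables, the variables of one set commuting with those of the
   other: f (x) g is the product of f in the first set and g in the second. *)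
Definition tens_series (f g : ncsym) : word * word -> rat^o :=
  fun uv => f uv.1 * g uv.2.

Definition ncsym2_pred : {pred word * word -> rat^o} := fun F =>
  `[< exists s : seq (ncsym * ncsym),
        F = \sum_(fg <- s) tens_series fg.1 fg.2 >].

Lemma ncsym2_submod_closed : submod_closed ncsym2_pred.
Proof.
split=> [|a F G /asboolP[s ->] /asboolP[t ->]]; apply/asboolP.
  by exists [::]; rewrite big_nil.
exists ([seq (a *: fg.1, fg.2) | fg <- s] ++ t).
rewrite big_cat big_map scaler_sumr; congr (_ + _).
by apply: eq_bigr => fg _; apply/funext => uv; apply: mulrA.
Qed.

HB.instance Definition _ := GRing.isSubmodClosed.Build
  rat (word * word -> rat^o) ncsym2_pred ncsym2_submod_closed.

Record ncsym2 :=
  NCSym2 { nc2_val :> word * word -> rat^o; _ : nc2_val \in ncsym2_pred }.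

HB.instance Definition _ := [isSub for nc2_val].
HB.instance Definition _ := [Choice of ncsym2 by <:].
HB.instance Definition _ := [SubChoice_isSubLmodule of ncsym2 by <:].

Lemma tens_subproof (f g : ncsym) : tens_series f g \in ncsym2_pred.
Proof. by apply/asboolP; exists [:: (f, g)]; rewrite big_seq1. Qed.

Definition tens (f g : ncsym) : ncsym2 := NCSym2 (tens_subproof f g).

Notation "f ⊗ g" := (tens f g) (at level 40, left associativity) : ring_scope.

Definition p_series n (pi : setpart n) : word -> rat^o := fun w =>
  ((size w == n) &&
   [forall B in val pi, forall j in B, forall k in B,
      nth 0%N w j == nth 0%N w k])%:R.

Lemma p_subproof n (pi : setpart n) : p_series pi \in ncsym_pred.
Proof.
apply/asboolP; split=> [|s /bij_inj s_inj w]; rewrite /p_series.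
  by exists n => w; case: eqP => // ->; rewrite ltnn.
rewrite size_map; case: eqP => //= size_w; congr ((nat_of_bool _)%:R).
apply: eq_forallb => B; congr (_ ==> _).
apply: eq_forallb => j; congr (_ ==> _).
apply: eq_forallb => k; congr (_ ==> _).
by rewrite !(nth_map 0%N) ?size_w // (inj_eq s_inj).
Qed.

Definition p n (pi : setpart n) : ncsym := NCSym (p_subproof pi).

(* As the p_pi form a basis of NCSym, exactly one linear map satisfies this. *)
Definition is_coproduct (Delta : ncsym -> ncsym2) : Prop :=
  forall (n : nat) (pi : setpart n),
    Delta (p pi) =
    \sum_(S : {set 'I_n} * {set 'I_n} |
            decomposition S.1 S.2 && splits pi S.1 S.2)
      p (tagged (std_restr pi S.1)) ⊗ p (tagged (std_restr pi S.2)).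

Definition x n (pi : setpart n) : ncsym :=
  \sum_(sigma : setpart n | refines sigma pi) moebius sigma pi *: p sigma.

(* c is the (finitely supported) family of coefficients of F in the tensors
   x_alpha (x) x_beta. *)
Definition x_expansion (F : ncsym2) (c : {fsfun spart * spart -> rat with 0}) :
    Prop :=
  F = \sum_(ab <- finsupp c) c ab *: (x (tagged ab.1) ⊗ x (tagged ab.2)).

(* Main.v *)
(* Moebius inversion turns x_pi = sum_(s <= pi) u(s, pi) p_s into
   p_pi = sum_(s <= pi) x_s.  As u(nu, [[n]]) = (-1)^(l(nu)-1) (l(nu)-1)!,
   applying Delta to x_[[n]] = sum_nu u(nu, [[n]]) p_nu and expanding both
   tensor factors of each term in the x-basis gives the coefficients.

   The inversion formula sum_(rho <= P <= pi) u(P, pi) = [rho = pi] is proved by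
   cancellation: if a block A of rho is strictly contained in a block D of pi,
   each term where A is a block of P, P having m blocks inside D, is cancelled
   by the m - 1 terms where A is united with another block of P inside D.

   For uniqueness of the coefficients, p_s takes the value [s <= pi] on the word
   whose i-th letter encodes the block of i in pi.  Hence inverting matrices
   gives linear forms dual to the x_pi, and their products are dual to the
   tensors. *)
Require Import Defs.
From HB Require Import structures.
From mathcomp Require Import all_boot all_order all_algebra ring.
From mathcomp Require Import finmap.
From mathcomp Require Import boolp.

Set Implicit Arguments.
Unset Strict Implicit.
Unset Printing Implicit Defensive.

Import GRing.Theory.

Local Open Scope ring_scope.

(** * Refinement of set partitions and the Möbius inversion formula *)

Section PartitionRefinement.

Variable T : finType.
Implicit Types (A B C D : {set T}) (P Q R rho pi : {set {set T}}).

Definition blocks_refine P Q : bool :=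
  [forall B in P, exists C in Q, B \subset C].

Lemma blocks_refineP P Q :
  reflect (forall B, B \in P -> exists2 C, C \in Q & B \subset C)
          (blocks_refine P Q).
Proof.
apply: (iffP forall_inP) => PQ B BP; first by have /exists_inP := PQ B BP.
by apply/exists_inP; apply: PQ.
Qed.

Lemma blocks_refine_refl P : blocks_refine P P.
Proof. by apply/blocks_refineP => B; exists B. Qed.

Lemma blocks_refine_trans Q P R :
  blocks_refine P Q -> blocks_refine Q R -> blocks_refine P R.
Proof.
move=> /blocks_refineP PQ /blocks_refineP QR; apply/blocks_refineP => B.
move=> /PQ[C /QR[D DR CD] BC]; exists D => //; exact: subset_trans CD.
Qed.

Lemma partition_block_subset P (V : {set T}) B C :
  partition P V -> B \in P -> C \in P -> B \subset C -> B = C.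
Proof.
move=> partP BP CP sBC; have [//|neqBC] := eqVneq B C.
have /trivIsetP/(_ _ _ BP CP neqBC) := partition_trivIset partP.
have /set0Pn[i iB] := partition_neq0 partP BP.
by move=> /disjointFr/(_ iB); rewrite (subsetP sBC).
Qed.

Lemma partition_subset_eq P Q (V : {set T}) :
  partition P V -> partition Q V -> P \subset Q -> P = Q.
Proof.
move=> partP partQ sPQ; apply/eqP; rewrite eqEsubset sPQ /=.
apply/subsetP => B BQ; have /set0Pn[i iB] := partition_neq0 partQ BQ.
have : i \in cover P.
  by rewrite (cover_partition partP) (subsetP (partitionS partQ BQ)).
move=> /bigcupP[C CP iC].
have tiQ := partition_trivIset partQ.
by rewrite -(def_pblock tiQ BQ iB) (def_pblock tiQ (subsetP sPQ _ CP) iC).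
Qed.

Lemma blocks_refine_anti P Q (V : {set T}) :
  partition P V -> partition Q V ->
  blocks_refine P Q -> blocks_refine Q P -> P = Q.
Proof.
move=> partP partQ /blocks_refineP PQ /blocks_refineP QP.
apply: (partition_subset_eq partP partQ); apply/subsetP => B BP.
have [C CQ BC] := PQ B BP; have [D DP CD] := QP C CQ.
have BD := partition_block_subset partP BP DP (subset_trans BC CD).
suff -> : B = C by [].
by apply/eqP; rewrite eqEsubset BC BD.
Qed.

Definition moebius_weight (m : nat) : rat := (-1) ^+ m.-1 * (m.-1)`!%:R.

Lemma moebius_weightS m :
  moebius_weight m.+2 = - (m.+1%:R * moebius_weight m.+1).
Proof. by rewrite /moebius_weight /= exprS factS natrM; ring. Qed.

Definition blocks_in P D := [set B in P | B \subset D].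

Definition blocks_moebius P Q : rat :=
  \prod_(D in Q) moebius_weight #|blocks_in P D|.

Lemma blocks_moebius_refl P (V : {set T}) :
  partition P V -> blocks_moebius P P = 1.
Proof.
move=> partP; rewrite /blocks_moebius big1 // => D DP.
suff -> : blocks_in P D = [set D] by rewrite cards1.
apply/setP => B; rewrite !inE; apply/andP/eqP => [[BP BD]|->] //.
exact: partition_block_subset partP _ _ BD.
Qed.

(** A point of [D] outside [A] lies in another block of [P], and the block of [pi] containing that
    one meets [D], hence is [D]. *)
Lemma card_blocks_in_ge2 P pi A D :
  partition P [set: T] -> partition pi [set: T] -> blocks_refine P pi ->
  A \in P -> D \in pi -> A \proper D -> (1 < #|blocks_in P D|)%N.
Proof.
move=> partP partpi /blocks_refineP Ppi AP Dpi /properP[AD [d dD dA]].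
have tiP := partition_trivIset partP; have tipi := partition_trivIset partpi.
have dP : d \in cover P by rewrite (cover_partition partP).
have [E Epi CE] := Ppi _ (pblock_mem dP).
have dE : d \in E by rewrite (subsetP CE) // mem_pblock.
have CD : pblock P d \subset D.
  by rewrite -(def_pblock tipi Dpi dD) (def_pblock tipi Epi dE).
apply/card_gt1P; exists A, (pblock P d).
rewrite !inE AP AD pblock_mem // CD; split => //.
by apply: contraNneq dA => ->; rewrite mem_pblock.
Qed.

Section MergeSplit.

Variables (rho pi : {set {set T}}) (A D : {set T}) (a : T).
Hypotheses (partrho : partition rho [set: T]) (partpi : partition pi [set: T]).
Hypotheses (Arho : A \in rho) (Dpi : D \in pi) (AD : A \proper D).
Hypothesis aA : a \in A.

Definition refinement_interval P :=
  [&& partition P [set: T], blocks_refine rho P & blocks_refine P pi].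

(* The sign-reversing correspondence: a partition P of the interval having A as
   a block, with another block C of P inside D, corresponds to the partition of
   the interval obtained by uniting A and C, in which A is not a block. *)
Definition merge (PC : {set {set T}} * {set T}) :=
  A :|: PC.2 |: PC.1 :\ A :\ PC.2.

(** The point [a] of [A] serves to pick out the block of [Q] that contains [A]; cutting [A] off this
    block undoes [merge]. *)
Definition split Q :=
  let B := pblock Q a in (A |: (B :\: A |: Q :\ B), B :\: A).

Definition mergeable (PC : {set {set T}} * {set T}) :=
  [&& refinement_interval PC.1, A \in PC.1, PC.2 \in PC.1, PC.2 != A
    & PC.2 \subset D].

Lemma merge_setD P C (V : {set T}) : partition P V -> A \in P -> C \in P ->
  C != A -> partition (P :\ A :\ C) (V :\: A :\: C).
Proof.
move=> partP AP CP neqCA; apply: partitionD1; first exact: partitionD1.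
by rewrite !inE neqCA.
Qed.

Lemma merge_notin P C (V : {set T}) : partition P V -> A \in P -> C \in P ->
  C != A -> A :|: C \notin P.
Proof.
move=> partP AP CP neqCA; apply: contra neqCA => ACP.
rewrite (partition_block_subset partP AP ACP (subsetUl _ _)).
by rewrite -(partition_block_subset partP CP ACP (subsetUr _ _)).
Qed.

Lemma merge_partition P C : partition P [set: T] -> A \in P -> C \in P ->
  C != A -> partition (merge (P, C)) [set: T].
Proof.
move=> partP AP CP neqCA; rewrite /merge /=.
have -> : [set: T] = A :|: C :|: ([set: T] :\: A :\: C).
  by apply/setP => i; rewrite !inE; case: (i \in A); case: (i \in C).
apply: (partitionU1 (merge_setD partP AP CP neqCA)).
  by apply/set0Pn; exists a; rewrite inE aA.
rewrite -setI_eq0; apply/eqP/setP => i; rewrite !inE.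
by case: (i \in A); case: (i \in C).
Qed.

Lemma mergeK PC : mergeable PC ->
  [/\ refinement_interval (merge PC), A \notin merge PC
    & split (merge PC) = PC].
Proof.
case: PC => P C /and5P[/= /and3P[partP /blocks_refineP rhoP]].
move=> /blocks_refineP Ppi AP CP neqCA CD.
have partQ := merge_partition partP AP CP neqCA.
have disAC : [disjoint A & C].
  by have /trivIsetP := partition_trivIset partP; apply; rewrite // eq_sym.
have ACQ : A :|: C \in merge (P, C) by rewrite !inE eqxx.
have ACNP := merge_notin partP AP CP neqCA.
split.
- apply/and3P; split=> //; apply/blocks_refineP => B.
    move=> /rhoP[E EP BE]; have [EA|neqEA] := eqVneq E A.
      by exists (A :|: C) => //; rewrite -EA subsetU // BE.
    have [EC|neqEC] := eqVneq E C.
      by exists (A :|: C) => //; rewrite -EC subsetU // BE orbT.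
    by exists E => //; rewrite !inE neqEA neqEC EP orbT.
  rewrite !inE => /predU1P[->|/and3P[_ _ /Ppi //]].
  by exists D; rewrite // subUset CD (proper_sub AD).
- rewrite !inE eqxx /= andbF orbF.
  by apply: contra ACNP => /eqP <-.
- rewrite /split; have -> : pblock (merge (P, C)) a = A :|: C.
    by apply: def_pblock (partition_trivIset partQ) ACQ _; rewrite inE aA.
  have -> : (A :|: C) :\: A = C.
    rewrite setDUl setDv set0U; apply/setDidPl; by rewrite disjoint_sym.
  congr (_, _); rewrite /merge /= setU1K; last first.
    by rewrite !inE (negPf ACNP) !andbF.
  by rewrite setD1K ?setD1K // !inE neqCA.
Qed.

(** As [rho] refines [Q], some block [B] of [Q] contains [A], strictly since [A] is not a block of
    [Q]. The block of [pi] around [B] contains [a], so it is [D]. The other blocks of [rho] are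
    disjoint from [A], so those inside [B] fit in [B :\: A]. *)
Lemma splitK Q : refinement_interval Q -> A \notin Q ->
  mergeable (split Q) /\ merge (split Q) = Q.
Proof.
move=> /and3P[partQ /blocks_refineP rhoQ /blocks_refineP Qpi] AnQ.
have tiQ := partition_trivIset partQ; have tipi := partition_trivIset partpi.
have [B BQ AB] := rhoQ A Arho; have aB := subsetP AB a aA.
rewrite /split (def_pblock tiQ BQ aB).
set C := B :\: A; set R := Q :\ B; set P := A |: _.
have partR : partition R ([set: T] :\: B) by apply: partitionD1.
have neqBA : B != A by apply: contraNneq AnQ => <-.
have C0 : C != set0.
  by rewrite /C setD_eq0; apply: contra neqBA => BA; rewrite eqEsubset BA.
have neqCA : C != A.
  by apply: contraTneq aA => <-; rewrite !inE aA.
have ACB : A :|: C = B.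
  apply/setP => i; rewrite !inE.
  by case: (boolP (i \in A)) => // /(subsetP AB) ->.
have disR (X : {set T}) : X \subset B -> [disjoint X & [set: T] :\: B].
  move=> XB; rewrite -setI_eq0; apply/eqP/setP => i; rewrite !inE.
  by case: (boolP (i \in X)) => // /(subsetP XB) ->.
have A0 : A != set0 by apply/set0Pn; exists a.
have CB : C \subset B by rewrite subsetDl.
(* A block of [Q] contained in [B] is [B] itself, which [R] leaves out. *)
have RnX (X : {set T}) : X != set0 -> X \subset B -> X \notin R.
  move=> X0 XB; rewrite !inE negb_and negbK orbC -implybE; apply/implyP => XQ.
  by rewrite (partition_block_subset partQ XQ BQ XB).
have AnCR : A \notin C |: R.
  by rewrite in_setU1 negb_or eq_sym neqCA (RnX _ A0 AB).
have CnR : C \notin R by apply: RnX.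
have partP : partition P [set: T].
  have -> : [set: T] = A :|: (C :|: ([set: T] :\: B)).
    by rewrite setUA ACB setTD setUCr.
  apply: partitionU1 => //; first exact: (partitionU1 partR C0 (disR _ CB)).
  rewrite -setI_eq0 setIUr setU_eq0 !setI_eq0 (disR A AB) andbT.
  by rewrite disjoint_sym disjoints_subset /C setDE subsetIr.
have mergeQ : merge (P, C) = Q.
  by rewrite /merge /= ACB setU1K // setU1K // setD1K.
have [E Epi BE] := Qpi B BQ.
have ED : E = D.
  have aE := subsetP BE a aB; have aD := subsetP (proper_sub AD) a aA.
  by rewrite -(def_pblock tipi Epi aE) (def_pblock tipi Dpi aD).
rewrite ED in BE; split=> //; apply/and5P; split=> //=.
- apply/and3P; split=> //; apply/blocks_refineP => X.
    move=> Xrho; have [XA|neqXA] := eqVneq X A.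
      by exists A; rewrite ?inE ?eqxx // XA.
    have [Y YQ XY] := rhoQ X Xrho; have [YB|neqYB] := eqVneq Y B.
      exists C; first by rewrite !inE eqxx orbT.
      rewrite subsetD -YB XY /=.
      by have /trivIsetP := partition_trivIset partrho; apply.
    by exists Y => //; rewrite !inE neqYB YQ !orbT.
  rewrite !inE => /or3P[/eqP->|/eqP->|/andP[_ /Qpi //]].
    by exists D; rewrite // (proper_sub AD).
  by exists D; rewrite // (subset_trans CB).
- by rewrite !inE eqxx.
- by rewrite !inE eqxx orbT.
- exact: subset_trans CB BE.
Qed.

(** Only the factor at [D] changes: the number of blocks inside [D] drops by one, and
    [moebius_weightS] compares the two weights. *)
Lemma blocks_moebius_merge PC : mergeable PC ->
  blocks_moebius PC.1 pi =
  - (#|blocks_in PC.1 D|.-1%:R * blocks_moebius (merge PC) pi).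
Proof.
case: PC => P C /and5P[/= /and3P[partP rhoP Ppi] AP CP neqCA CD].
rewrite /blocks_moebius (bigD1 D) //= [in RHS](bigD1 D) //= mulrA -mulNr.
set R := P :\ A :\ C.
have PE : P = A |: (C |: R) by rewrite /R setD1K ?setD1K // !inE neqCA.
have sAD := proper_sub AD.
have ACnP := merge_notin partP AP CP neqCA.
have cardQ : #|blocks_in (merge (P, C)) D| = #|blocks_in R D|.+1.
  have -> : blocks_in (merge (P, C)) D = A :|: C |: blocks_in R D.
    apply/setP => X; rewrite !inE.
    by case: eqP => // ->; rewrite subUset sAD CD.
  by rewrite cardsU1 !inE (negPf ACnP) !andbF.
have cardP : #|blocks_in P D| = #|blocks_in R D|.+2.
  have -> : blocks_in P D = A |: (C |: blocks_in R D).
    apply/setP => X; rewrite {1}PE !inE.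
    by do 2![case: eqP => [->|_] /=; rewrite ?sAD ?CD //].
  by rewrite !cardsU1 !inE !eqxx [A == C]eq_sym (negPf neqCA) ?andbF.
rewrite cardP cardQ moebius_weightS; congr (_ * _).
apply: eq_bigr => E /andP[Epi neqED]; congr (moebius_weight #|pred_of_set _|).
(* Hence none of [A], [C] and their union is counted in a block [E] of [pi] other than [D]. *)
have disE (X : {set T}) : X != set0 -> X \subset D -> ~~ (X \subset E).
  move=> /set0Pn[i iX] XD; apply/negP => XE; case/negP: neqED.
  have tipi := partition_trivIset partpi; apply/eqP.
  rewrite -(def_pblock tipi Epi (subsetP XE i iX)).
  exact: def_pblock tipi Dpi (subsetP XD i iX).
have A0 : A != set0 by apply/set0Pn; exists a.
have C0 := partition_neq0 partP CP.
apply/setP => X; rewrite {1}PE !inE; case: (boolP (X \subset E)) => [XE|].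
  rewrite !andbT; have -> : (X == A) = false.
    by apply: contraTF XE => /eqP->; apply: disE.
  have -> : (X == C) = false by apply: contraTF XE => /eqP->; apply: disE.
  suff -> : (X == A :|: C) = false by [].
  apply: contraTF XE => /eqP->; apply: disE; last by rewrite subUset sAD CD.
  by rewrite setU_eq0 negb_and A0.
by rewrite !andbF.
Qed.

End MergeSplit.

Lemma sum_blocks_moebius rho pi :
  partition rho [set: T] -> partition pi [set: T] ->
  \sum_(P | refinement_interval rho pi P) blocks_moebius P pi = (rho == pi)%:R.
Proof.
move=> partrho partpi; have [<-|neq] := eqVneq rho pi.
  rewrite (big_pred1 rho) ?(blocks_moebius_refl partrho) // => P.
  apply/and3P/eqP => [[partP rP Pr]|->].
    exact: (blocks_refine_anti partP partrho Pr rP).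
  by split; rewrite ?blocks_refine_refl.
have [rhopi|rhopi] := boolP (blocks_refine rho pi); last first.
  rewrite big1 // => P /and3P[_ rP Pp].
  by rewrite (blocks_refine_trans rP Pp) in rhopi.
have /subsetPn[A Arho Anpi] : ~~ (rho \subset pi).
  by apply: contra neq => /(partition_subset_eq partrho partpi) ->.
have /blocks_refineP/(_ A Arho)[D Dpi sAD] := rhopi.
have AD : A \proper D.
  by rewrite properEneq sAD andbT; apply: contraNneq Anpi => ->.
have /set0Pn[a aA] := partition_neq0 partrho Arho.
(* The partitions without the block [A] are reindexed by the mergeable pairs [(P, C)], then grouped
   by [P]. *)
rewrite (bigID (fun P => A \in P)) /=.
rewrite [X in _ + X](reindex_onto (merge A) (split A a)) /=; last first.
  move=> Q /andP[IQ AnQ].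
  by have [] := splitK partrho partpi Arho Dpi AD aA IQ AnQ.
rewrite (eq_bigl (mergeable rho pi A D)) => [|PC]; last first.
  apply/idP/idP => [/andP[/andP[IQ AnQ] /eqP <-]|].
    by have [] := splitK partrho partpi Arho Dpi AD aA IQ AnQ.
  by move=> /(mergeK Dpi AD aA)[-> -> ->]; rewrite eqxx.
rewrite (eq_bigl (fun PC => (refinement_interval rho pi PC.1 && (A \in PC.1)) &&
    [&& PC.2 \in PC.1, PC.2 != A & PC.2 \subset D])); last first.
  by move=> PC; rewrite /mergeable -!andbA.
rewrite -(pair_big_dep (fun P => refinement_interval rho pi P && (A \in P))
  (fun P C => [&& C \in P, C != A & C \subset D])
  (fun P C => blocks_moebius (merge A (P, C)) pi)) /=.
rewrite -big_split big1 //= => P /andP[IP AP].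
have /and3P[partP rhoP Ppi] := IP.
have gt1 := card_blocks_in_ge2 partP partpi Ppi AP Dpi AD.
set m := #|blocks_in P D| in gt1 *.
have m1 : m.-1%:R != 0 :> rat.
  by rewrite Num.Theory.pnatr_eq0 -lt0n -subn1 subn_gt0.
(* Solved for the merged partition, [blocks_moebius_merge] gives a term that does not depend on [C];
   the [m.-1] choices of [C] then add up to minus the term of [P]. *)
rewrite (eq_bigr (fun=> - (m.-1%:R^-1 * blocks_moebius P pi))); last first.
  move=> C /and3P[CP neqCA CD].
  have IC : mergeable rho pi A D (P, C) by apply/and5P.
  rewrite (blocks_moebius_merge partpi Dpi AD aA IC) /=.
  by rewrite mulrN opprK mulKf.
rewrite sumr_const -cardsE.
have -> : #|[set C | [&& C \in P, C != A & C \subset D]]| = m.-1.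
  rewrite /m (cardsD1 A (blocks_in P D)) inE AP (proper_sub AD) /=.
  by apply: eq_card => C; rewrite !inE andbCA.
by rewrite mulNrn -[X in _ - X]mulr_natl mulVKf // subrr.
Qed.

End PartitionRefinement.

(** A one-sided inverse of a square matrix over a commutative ring is two-sided. *)
Lemma sum_mul_deltaC (R : comNzRingType) (I : finType) (f g : I -> I -> R) :
  (forall i k, \sum_j f i j * g j k = (i == k)%:R) ->
  forall i k, \sum_j g i j * f j k = (i == k)%:R.
Proof.
move=> fg i k.
pose F := \matrix_(r, s < #|I|) f (enum_val r) (enum_val s).
pose G := \matrix_(r, s < #|I|) g (enum_val r) (enum_val s).
have mulE (u v : I -> I -> R) r s :
    ((\matrix_(r', s' < #|I|) u (enum_val r') (enum_val s')) *m
     (\matrix_(r', s' < #|I|) v (enum_val r') (enum_val s'))) r s =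
    \sum_j u (enum_val r) j * v j (enum_val s).
  rewrite mxE [RHS]big_enum_val; apply: eq_bigr => t _.
  by rewrite !mxE.
have /mulmx1C FG1 : F *m G = 1%:M.
  by apply/matrixP => r s; rewrite mulE fg mxE (inj_eq enum_val_inj).
have /matrixP/(_ (enum_rank i) (enum_rank k)) := FG1.
by rewrite mulE mxE !enum_rankK (inj_eq enum_rank_inj).
Qed.

(** * Change of basis between the [p] and the [x] of a fixed degree *)

Section FixedSize.

Variable n : nat.
Implicit Types rho sigma pi alpha beta : setpart n.

(** Extending [moebius] by zero turns sums over intervals into matrix products. *)
Definition mu sigma pi : rat :=
  if refines sigma pi then moebius sigma pi else 0.

Definition zeta sigma pi : rat := (refines sigma pi)%:R.

Lemma sum_zeta_mu rho pi :
  \sum_sigma zeta rho sigma * mu sigma pi = (rho == pi)%:R.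
Proof.
rewrite -val_eqE -(sum_blocks_moebius (valP rho) (valP pi)).
(* The interval consists of partitions, so its sum can be taken over [setpart n]. *)
rewrite [RHS](reindex_omap (val : setpart n -> _) insub); last first.
  by move=> P /and3P[partP _ _]; rewrite insubT.
rewrite [RHS]big_mkcond /=; apply: eq_bigr => sigma _.
rewrite valK eqxx andbT /refinement_interval /= (svalP sigma) /= /zeta /mu.
rewrite -[refines rho _]/(blocks_refine _ _).
rewrite -[refines _ pi]/(blocks_refine _ _).
by case: blocks_refine; case: blocks_refine; rewrite ?mul1r ?mul0r.
Qed.

Lemma sum_mu_zeta rho pi :
  \sum_sigma mu rho sigma * zeta sigma pi = (rho == pi)%:R.
Proof. exact: (sum_mul_deltaC sum_zeta_mu). Qed.

Lemma x_mu pi : x pi = \sum_sigma mu sigma pi *: p sigma.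
Proof.
rewrite /x big_mkcond; apply: eq_bigr => sigma _.
by rewrite /mu; case: ifP => // _; rewrite scale0r.
Qed.

Lemma p_zeta pi : p pi = \sum_sigma zeta sigma pi *: x sigma.
Proof.
under eq_bigr => sigma _ do rewrite x_mu scaler_sumr.
rewrite exchange_big /=.
under eq_bigr => rho _.
  under eq_bigr => sigma _ do rewrite scalerA mulrC.
  rewrite -scaler_suml sum_mu_zeta; over.
rewrite (bigD1 pi) //= eqxx scale1r big1 ?addr0 // => rho /negPf->.
by rewrite scale0r.
Qed.

(** Numbering all subsets by [enum_rank] makes two letters equal exactly when their positions share
    a block. *)
Definition block_word pi : word :=
  [seq (enum_rank (pblock (val pi) i) : nat) | i <- enum 'I_n].

Lemma size_block_word pi : size (block_word pi) = n.
Proof. by rewrite size_map size_enum_ord. Qed.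

Lemma nth_block_word pi (i : 'I_n) :
  nth 0%N (block_word pi) i = enum_rank (pblock (val pi) i).
Proof. by rewrite (nth_map i) ?size_enum_ord // nth_ord_enum. Qed.

Lemma p_block_word sigma pi : p sigma (block_word pi) = zeta sigma pi.
Proof.
rewrite /= /p_series size_block_word eqxx /=; congr ((nat_of_bool _)%:R).
have partpi := valP pi; have partsigma := valP sigma.
have inpi i : i \in cover (val pi) by rewrite (cover_partition partpi).
apply: eq_forallb_in => B Bsigma.
apply/forall_inP/exists_inP => [BB|[C Cpi BC] j jB].
  have /set0Pn[i iB] := partition_neq0 partsigma Bsigma.
  exists (pblock (val pi) i); first exact: pblock_mem.
  apply/subsetP => j jB; have /forall_inP/(_ j jB) := BB i iB.
  rewrite !nth_block_word => /eqP/val_inj/enum_rank_inj ->.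
  by rewrite mem_pblock.
apply/forall_inP => k kB; have tipi := partition_trivIset partpi.
rewrite !nth_block_word (def_pblock tipi Cpi (subsetP BC j jB)).
by rewrite (def_pblock tipi Cpi (subsetP BC k kB)).
Qed.

End FixedSize.

(** * Linear forms dual to the [x] and to their tensors *)

Lemma p_size n (pi : setpart n) (w : word) : size w != n -> p pi w = 0.
Proof. by rewrite /= /p_series => /negPf ->. Qed.

Lemma ncsym_sumE (I : Type) (r : seq I) (P : pred I) (F : I -> ncsym) w :
  nc_val (\sum_(i <- r | P i) F i) w = \sum_(i <- r | P i) nc_val (F i) w.
Proof. by elim/big_rec2: _ => // i y f _ <-. Qed.

Lemma ncsym_scaleE a (f : ncsym) w : nc_val (a *: f) w = a * nc_val f w.
Proof. by []. Qed.

Lemma ncsym2_ext (F G : ncsym2) : nc2_val F =1 nc2_val G -> F = G.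
Proof. by move=> FG; apply: val_inj; apply/funext. Qed.

Lemma ncsym2_sumE (I : Type) (r : seq I) (P : pred I) (F : I -> ncsym2) w :
  nc2_val (\sum_(i <- r | P i) F i) w = \sum_(i <- r | P i) nc2_val (F i) w.
Proof. by elim/big_rec2: _ => // i y f _ <-. Qed.

Lemma x_size n (pi : setpart n) (w : word) : size w != n -> x pi w = 0.
Proof.
move=> szw; rewrite x_mu ncsym_sumE big1 // => sigma _.
by rewrite ncsym_scaleE p_size // mulr0.
Qed.

(* This matrix is inverse to (x alpha (block_word beta)), which is the product
   of the transpose of mu by zeta, since zeta and mu are inverse matrices. *)
Definition xcoef_weight n (beta alpha : setpart n) : rat :=
  \sum_rho mu beta rho * zeta alpha rho.

(** Only words of length [tag a] are evaluated, so the other degrees of [f] do not contribute. *)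
Definition xcoef (a : spart) (f : ncsym) : rat :=
  \sum_beta f (block_word beta) * xcoef_weight beta (tagged a).

Lemma xcoef_is_linear a : linear_for *%R (xcoef a).
Proof.
move=> c f g; rewrite /xcoef mulr_sumr -big_split; apply: eq_bigr => beta _ /=.
by rewrite mulrA; exact: mulrDl.
Qed.

HB.instance Definition _ a :=
  GRing.isLinear.Build rat ncsym rat *%R (xcoef a) (xcoef_is_linear a).

Lemma xcoef_x a b : xcoef a (x (tagged b)) = (a == b)%:R.
Proof.
case: a b => k alpha [l beta] /=; rewrite /xcoef /=.
have [ekl|nkl] := eqVneq k l; last first.
  rewrite big1 => [|gamma _]; last by rewrite x_size ?mul0r ?size_block_word.
  by case: eqP => // - [/eqP]; rewrite (negPf nkl).
rewrite -{}ekl {l} in beta *; rewrite -tag_eqE /tag_eq /= eqxx tagged_asE /=.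
(* Summing over [gamma] first forces [rho = delta]; what remains is the product of [zeta] and [mu]
   at [(alpha, beta)]. *)
transitivity (\sum_gamma \sum_delta \sum_rho
    (mu delta beta * zeta alpha rho) * (zeta delta gamma * mu gamma rho)).
  apply: eq_bigr => gamma _; rewrite x_mu ncsym_sumE mulr_suml.
  apply: eq_bigr => delta _; rewrite /xcoef_weight mulr_sumr.
  apply: eq_bigr => rho _; rewrite ncsym_scaleE p_block_word.
  by rewrite [_ * zeta alpha rho]mulrC mulrACA.
rewrite -sum_zeta_mu exchange_big; apply: eq_bigr => delta _ /=.
rewrite exchange_big (bigD1 delta) //= [X in _ + X]big1 => [|rho neq].
  by rewrite -mulr_sumr sum_zeta_mu eqxx mulr1 addr0 mulrC.
by rewrite -mulr_sumr sum_zeta_mu eq_sym (negPf neq) mulr0.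
Qed.

(** By [p_zeta], [p pi] is the sum of the [x sigma] with [sigma] refining [pi]. This is the source
    of the refinement conditions in the final sum. *)
Lemma xcoef_p a n (pi : setpart n) :
  xcoef a (p pi) = (srefines a (Tagged setpart pi))%:R.
Proof.
have xE sigma : xcoef a (x sigma) = (a == Tagged setpart sigma)%:R.
  exact: (xcoef_x a (Tagged setpart sigma)).
rewrite p_zeta linear_sum /=.
under eq_bigr => sigma _ do rewrite linearZ /= xE.
case: a xE => k alpha _; rewrite /srefines /=.
have [ekn|nkn] := eqVneq k n; last first.
  rewrite big1 => // sigma _.
  by case: eqP => [[/eqP]|_]; [rewrite (negPf nkn) | rewrite mulr0].
rewrite -{}ekn {n} in pi *; rewrite tagged_asE /=.
rewrite (bigD1 alpha) //= eqxx mulr1 big1 ?addr0 // => sigma neq.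
by rewrite -tag_eqE /tag_eq /= eqxx tagged_asE eq_sym (negPf neq) mulr0.
Qed.

(** The tensor product of two forms [xcoef], written through values at pairs of words so that it
    applies to sums of tensors as well. *)
Definition xxcoef (ab : spart * spart) (F : ncsym2) : rat :=
  \sum_beta \sum_gamma F (block_word beta, block_word gamma) *
    (xcoef_weight beta (tagged ab.1) * xcoef_weight gamma (tagged ab.2)).

Lemma xxcoef_is_linear ab : linear_for *%R (xxcoef ab).
Proof.
move=> c F G; rewrite /xxcoef mulr_sumr -big_split; apply: eq_bigr => beta _ /=.
rewrite mulr_sumr -big_split; apply: eq_bigr => gamma _ /=.
by rewrite [c * _]mulrA; exact: mulrDl.
Qed.

HB.instance Definition _ ab :=
  GRing.isLinear.Build rat ncsym2 rat *%R (xxcoef ab) (xxcoef_is_linear ab).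

Lemma xxcoef_tens ab f g : xxcoef ab (f ⊗ g) = xcoef ab.1 f * xcoef ab.2 g.
Proof.
rewrite /xxcoef /xcoef mulr_suml; apply: eq_bigr => beta _.
rewrite mulr_sumr; apply: eq_bigr => gamma _.
by rewrite mulrACA.
Qed.

Definition xx (ab : spart * spart) : ncsym2 :=
  x (tagged ab.1) ⊗ x (tagged ab.2).

Lemma xxcoef_xx ab cd : xxcoef ab (xx cd) = (ab == cd)%:R.
Proof.
by rewrite xxcoef_tens !xcoef_x -natrM mulnb; case: ab cd => [a b] [c d].
Qed.

Lemma x_expansion_coef F c ab : x_expansion F c -> c ab = xxcoef ab F.
Proof.
move=> ->; rewrite linear_sum /=.
under eq_bigr => cd _ do rewrite linearZ /= -/(xx cd) xxcoef_xx.
have [absupp|abnsupp] := boolP (ab \in finsupp c).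
  rewrite (big_fsetD1 ab) //= eqxx mulr1 big_seq big1 ?addr0 // => cd.
  by rewrite !inE eq_sym => /andP[/negPf-> _]; rewrite mulr0.
(* Outside the support both sides vanish: [c ab] is the default 0. *)
rewrite fsfun_dflt // big_seq big1 // => cd cdsupp.
by case: eqP abnsupp => [->|_]; rewrite ?cdsupp // mulr0.
Qed.

Lemma x_expansion_unique F c c' : x_expansion F c -> x_expansion F c' -> c' = c.
Proof.
move=> Fc Fc'; apply/fsfunP => ab.
by rewrite (x_expansion_coef _ Fc) (x_expansion_coef _ Fc').
Qed.

(** Indices may repeat in the list, so that sums are mere concatenations; [xx_span_expansion]
    collects like terms. *)
Definition in_xx_span (F : ncsym2) :=
  exists s : seq (rat * (spart * spart)), F = \sum_(t <- s) t.1 *: xx t.2.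

Lemma xx_span_expansion F : in_xx_span F -> exists c, x_expansion F c.
Proof.
move=> [s Fs]; pose K := [fset t.2 | t in s]%fset.
exists [fsfun ab in K => xxcoef ab F].
pose c := [fsfun ab in K => xxcoef ab F].
rewrite /x_expansion -/c.
(* Cancellation may make the support smaller than [K], but the extra terms are zero. *)
rewrite (@big_fset_incl _ _ _ _ _ K) /=; first last.
- by move=> ab _ /fsfun_dflt ->; rewrite scale0r.
- exact: finsupp_sub.
transitivity (\sum_(ab <- K) xxcoef ab F *: xx ab); last first.
  by apply: eq_big_seq => ab abK; rewrite fsfunE abK.
(* Expanding only the [F] under [xxcoef], each term of the list contributes its scalar at its own
   index. *)
rewrite {2}Fs.
under eq_bigr => ab _.
  rewrite linear_sum scaler_suml /=.
  under eq_bigr => t _ do rewrite linearZ /= xxcoef_xx.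
  over.
rewrite exchange_big Fs /=; apply: eq_big_seq => t ts.
have tK : t.2 \in K by apply/imfsetP; exists t.
rewrite (big_fsetD1 t.2) //= eqxx mulr1 big_seq big1 ?addr0 // => cd.
by rewrite !inE => /andP[/negPf-> _]; rewrite mulr0 scale0r.
Qed.

Lemma xx_span_sum (I : Type) (r : seq I) (P : pred I) (F : I -> ncsym2) :
  (forall i, P i -> in_xx_span (F i)) -> in_xx_span (\sum_(i <- r | P i) F i).
Proof.
move=> spanF; apply: big_rec => [|i G /spanF[s ->] [t ->]].
  by exists [::]; rewrite big_nil.
by exists (s ++ t); rewrite big_cat.
Qed.

Lemma xx_span_scale a F : in_xx_span F -> in_xx_span (a *: F).
Proof.
move=> [s ->]; exists [seq (a * t.1, t.2) | t <- s].
by rewrite big_map scaler_sumr; apply: eq_bigr => t _; rewrite scalerA.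
Qed.

Lemma xx_span_tens_p m n (alpha : setpart m) (beta : setpart n) :
  in_xx_span (p alpha ⊗ p beta).
Proof.
have -> : p alpha ⊗ p beta = \sum_sigma \sum_tau
    (zeta sigma alpha * zeta tau beta) *:
    xx (Tagged setpart sigma, Tagged setpart tau).
  apply: ncsym2_ext => -[u v]; rewrite ncsym2_sumE.
  rewrite -[LHS]/(nc_val (p alpha) u * nc_val (p beta) v) !p_zeta.
  rewrite !ncsym_sumE mulr_suml; apply: eq_bigr => sigma _.
  rewrite ncsym2_sumE mulr_sumr; apply: eq_bigr => tau _.
  exact: mulrACA.
do 2![apply: xx_span_sum => ? _].
by eexists [:: (_, _)]; rewrite big_seq1.
Qed.

(** * The coproduct of [x] at the one-block partition *)

Lemma moebius_one_block n (n_gt0 : (0 < n)%N) (nu : setpart n) :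
  moebius nu (one_block n_gt0) = moebius_weight (nblocks nu).
Proof.
rewrite /moebius big_set1 /= /moebius_weight /nblocks.
suff -> : [set B in val nu | B \subset [set: 'I_n]] = val nu by [].
by apply/setP => B; rewrite inE subsetT andbT.
Qed.

Lemma refines_one_block n (n_gt0 : (0 < n)%N) (nu : setpart n) :
  refines nu (one_block n_gt0).
Proof.
apply/forall_inP => B _; apply/exists_inP.
by exists setT; rewrite ?inE ?subsetT.
Qed.

Theorem corollary3p3 (Delta : {linear ncsym -> ncsym2})
    (DeltaP : is_coproduct Delta)
    (n : nat) (n_gt0 : (0 < n)%N) (k l : nat)
    (sigma : setpart k) (tau : setpart l) :
  exists c : {fsfun spart * spart -> rat with 0},
    [/\ x_expansion (Delta (x (one_block n_gt0))) c,
        forall c' : {fsfun spart * spart -> rat with 0},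
          x_expansion (Delta (x (one_block n_gt0))) c' -> c' = c
      & c (Tagged setpart sigma, Tagged setpart tau) =
        \sum_(t : setpart n * {set 'I_n} * {set 'I_n} |
                let: (nu, S1, S2) := t in
                [&& decomposition S1 S2, splits nu S1 S2,
                    srefines (Tagged setpart sigma) (std_restr nu S1)
                  & srefines (Tagged setpart tau) (std_restr nu S2)])
          (-1) ^+ (nblocks t.1.1).-1 * ((nblocks t.1.1).-1)`!%:R].
Proof.
set F := Delta _.
have FE : F = \sum_(nu : setpart n) moebius_weight (nblocks nu) *:
    \sum_(S : {set 'I_n} * {set 'I_n} |
            decomposition S.1 S.2 && splits nu S.1 S.2)
      p (tagged (std_restr nu S.1)) ⊗ p (tagged (std_restr nu S.2)).
  rewrite /F x_mu linear_sum; apply: eq_bigr => nu _ /=.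
  by rewrite /mu refines_one_block moebius_one_block linearZ /= DeltaP.
have /xx_span_expansion[c Fc] : in_xx_span F.
  rewrite FE; apply: xx_span_sum => nu _; apply: xx_span_scale.
  by apply: xx_span_sum => S _; apply: xx_span_tens_p.
exists c; split=> //; first by move=> c'; apply: x_expansion_unique.
rewrite (x_expansion_coef _ Fc) FE linear_sum /=.
(* Each tensor of two [p] contributes the product of two refinement indicators. *)
under eq_bigr => nu _.
  rewrite linearZ linear_sum /= mulr_sumr.
  under eq_bigr => S _.
    rewrite xxcoef_tens !xcoef_p -natrM mulnb; over.
  over.
pose h (q : setpart n * ({set 'I_n} * {set 'I_n})) := (q.1, q.2.1, q.2.2).
rewrite pair_big_dep [RHS](reindex h) /=; last first.
  by exists (fun t => (t.1.1, (t.1.2, t.2))) => [[nu [S1 S2]]|[[nu S1] S2]].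
(* The refinement conditions are a 0-1 factor on the left and part of the index condition on the
   right. *)
rewrite big_mkcond [RHS]big_mkcond; apply: eq_bigr => -[nu [S1 S2]] _ /=.
rewrite andbA; case: (decomposition _ _ && _) => //=.
by case: (_ && _); rewrite ?mulr1 ?mulr0.
Qed.
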